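(* Let $X$ be a non-empty set, let $\mathsf{FFBR}(X)$ be the free $X$-generated $F$-birestriction monoid, and let $$\mathcal F=\mathrm{BRestr}\langle X\cup\overline{X^+}\mid \overline{x}\ge x\ (x\in X),\ \ \overline{uv}\ge \overline{u}\,\overline{v}\ (u,v\in X^+)\rangle .$$ Then $\mathsf{FFBR}(X)$ and $\mathcal F$ are $(X\cup\overline{X^+})$-canonically $(2,1,1,0)$-isomorphic and $X$-canonically $(2,1,1,1,0)$-isomorphic.
   Context: A birestriction monoid is an algebra $(S;\cdot,{}^*,{}^+,1)$ such that $(S;\cdot,1)$ is a monoid and for all $x,y$: $xx^*=x$, $x^*y^*=y^*x^*$, $(xy^* )^*=x^*y^*$, $x^*y=y(xy)^*$; $x^+x=x$, $x^+y^+=y^+x^+$, $(x^+y)^+=x^+y^+$, $xy^+=(xy)^+x$; $(x^+)^*=x^+$, $(x^* )^+=x^*$. Its projections are $P(S)=\{s^*:s\in S\}=\{s^+:s\in S\}$. The natural partial order is: $s\le t$ iff $s=et$ for some $e\in P(S)$ (equivalently, $s=ts^*$; equivalently, $s=s^+t$). The relation $\sigma$ is the minimum congruence identifying all projections: $s\mathrel{\sigma}t$ iff $se=te$ for some $e\in P(S)$. A $(2,1,1,0)$-morphism preserves $\cdot,{}^*,{}^+,1$. An $F$-birestriction monoid is a birestriction monoid in which every $\sigma$-class has a maximum element with respect to the natural partial order; $s^{\mathfrak m}$ denotes the maximum element of the $\sigma$-class of $s$. $F$-birestriction monoids are regarded as algebras $(S;\cdot,{}^*,{}^+,{}^{\mathfrak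 m},1)$ of type $(2,1,1,1,0)$ (they form a variety), and $\mathsf{FFBR}(X)$ is the free algebra on $X$ in this variety. A $(2,1,1,1,0)$-morphism preserves all five operations. $X^+$ and $X^*$ are the free semigroup and free monoid on $X$; $\overline{X^+}=\{\overline{u}:u\in X^+\}$ is a set disjoint from $X$ in bijection with $X^+$. $\mathrm{BRestr}\langle Y\mid R\rangle$ is the quotient of the free birestriction monoid on $Y$ by the congruence generated by $R$; a relation $a\ge b$ abbreviates $b=ab^*$ (equivalently $b=b^+a$). A morphism between $Y$-generated algebras is $Y$-canonical if it commutes with the assignment maps from $Y$. $\mathsf{FFBR}(X)$ is viewed as an $(X\cup\overline{X^+})$-generated birestriction monoid via $x\mapsto x$ for $x\in X$ and $\overline{u}\mapsto u^{\mathfrak m}$ for $u\in X^+$ (where $u$ is evaluated as a product of generators); $\mathcal F$ is viewed as an $F$-birestriction monoid whose operation $^{\mathfrak m}$ takes an element to the maximum of its $\sigma$-class (that these maxima exist in $\mathcal F$ is part of the assertion), and as $X$-generated via $x\mapsto x$. *)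

(* Defs.v *)
From HB Require Import structures.
From mathcomp Require Import all_boot monoid generic_quotient.
From mathcomp Require Import boolp classical_sets.

Set Implicit Arguments.
Unset Strict Implicit.
Unset Printing Implicit Defensive.

Local Open Scope group_scope.
Local Open Scope quotient_scope.

HB.mixin Record Monoid_isBirestriction S of Monoid S := {
  bstar : S -> S;
  bplus : S -> S;
  mul_bstar : forall x : S, x * bstar x = x;
  bstarC : forall x y : S, bstar x * bstar y = bstar y * bstar x;
  bstarM : forall x y : S, bstar (x * bstar y) = bstar x * bstar y;
  bstar_mul : forall x y : S, bstar x * y = y * bstar (x * y);
  bplus_mul : forall x : S, bplus x * x = x;
  bplusC : forall x y : S, bplus x * bplus y = bplus y * bplus x;
  bplusM : forall x y : S, bplus (bplus x * y) = bplus x * bplus y;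
  mul_bplus : forall x y : S, x * bplus y = bplus (x * y) * x;
  bplusK : forall x : S, bstar (bplus x) = bplus x;
  bstarK : forall x : S, bplus (bstar x) = bstar x
}.

#[short(type="birestrictionType")]
HB.structure Definition BirestrictionMonoid :=
  {S of Monoid_isBirestriction S & Monoid S}.

Definition projection (S : birestrictionType) (e : S) : Prop :=
  exists s : S, e = bstar s.

Definition natle (S : birestrictionType) (s t : S) : Prop :=
  exists2 e : S, projection e & s = e * t.

(* The least (2,1,1,0)-congruence containing R *)
Inductive gen_cong (S : birestrictionType) (R : S -> S -> Prop) :
    S -> S -> Prop :=
  | gen_cong_base s t : R s t -> gen_cong R s t
  | gen_cong_refl s : gen_cong R s s
  | gen_cong_sym s t : gen_cong R s t -> gen_cong R t s
  | gen_cong_trans s t u : gen_cong R s t -> gen_cong R t u -> gen_cong R s u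
  | gen_cong_mul s s' t t' :
      gen_cong R s s' -> gen_cong R t t' -> gen_cong R (s * t) (s' * t')
  | gen_cong_star s t : gen_cong R s t -> gen_cong R (bstar s) (bstar t)
  | gen_cong_plus s t : gen_cong R s t -> gen_cong R (bplus s) (bplus t).

Definition sigma (S : birestrictionType) : S -> S -> Prop :=
  gen_cong (fun e f : S => projection e /\ projection f).

Definition sigma_max (S : birestrictionType) (s m : S) : Prop :=
  sigma s m /\ forall t : S, sigma s t -> natle t m.

Definition F_birestriction (S : birestrictionType) : Prop :=
  forall s : S, exists m : S, sigma_max s m.

(* The operation of an F-birestriction monoid sending s to the maximum of its
   sigma-class; the value is junk (s itself) where there is no maximum. *)
Definition bmax (S : birestrictionType) (s : S) : S :=
  xget s [set m | sigma_max s m]%classic.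

Definition birestriction_morphism (S T : birestrictionType) (f : S -> T) :=
  [/\ forall x y : S, f (x * y) = f x * f y,
      forall x : S, f (bstar x) = bstar (f x),
      forall x : S, f (bplus x) = bplus (f x)
    & f 1 = 1].

Definition F_birestriction_morphism (S T : birestrictionType) (f : S -> T) :=
  birestriction_morphism f /\ forall x : S, f (bmax x) = bmax (f x).

Section BirestrictionTheory.
Variable S : birestrictionType.
Implicit Types s t u v e f : S.

Lemma bstar_idem s : bstar (bstar s) = bstar s.
Proof. by rewrite -{1}(bstarK s) bplusK bstarK. Qed.

Lemma projK e : projection e -> bstar e = e.
Proof. by case=> s ->; rewrite bstar_idem. Qed.

Lemma projM e f : projection e -> projection f -> projection (e * f).
Proof. by move=> [s ->] [t ->]; exists (s * bstar t); rewrite bstarM. Qed.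

Lemma projC e f : projection e -> projection f -> e * f = f * e.
Proof. by move=> [s ->] [t ->]; rewrite bstarC. Qed.

Lemma proj_star s : projection (bstar s).
Proof. by exists s. Qed.

Lemma proj_plus s : projection (bplus s).
Proof. by exists (bplus s); rewrite bplusK. Qed.

Lemma proj1 : projection (1 : S).
Proof. by exists 1; rewrite -[LHS](mul_bstar 1) mul1g. Qed.

Lemma natle_star s t : natle s t <-> s = t * bstar s.
Proof.
split=> [[e pe ->]|->]; first by rewrite -{1}(projK pe) bstar_mul.
exists (bplus (t * bstar s)); first exact: proj_plus.
by rewrite -mul_bplus bstarK.
Qed.

Lemma projI e : projection e -> e * e = e.
Proof. by move=> pe; rewrite -{2}(projK pe) mul_bstar. Qed.

Lemma natle_plus s t : natle s t <-> s = bplus s * t.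
Proof.
split=> [[e pe ->]|->]; last by exists (bplus s) => //; exact: proj_plus.
have <- : bplus e = e by rewrite -{1}(projK pe) bstarK (projK pe).
by rewrite bplusM -mulgA bplus_mul.
Qed.

Lemma natle_anti s t : natle s t -> natle t s -> s = t.
Proof.
move=> /natle_star st /natle_star ts.
have E : bstar s = bstar t by rewrite {1}st {2}ts !bstarM bstarC.
by rewrite st E mul_bstar.
Qed.

Lemma sigmaP s t : sigma s t <-> exists2 e, projection e & s * e = t * e.
Proof.
split; last first.
  move=> [e pe E]; have sig a : sigma a (a * e).
    rewrite /sigma -{1}(mulg1 a); apply: gen_cong_mul; first exact: gen_cong_refl.
    by apply: gen_cong_base; split => //; exact: proj1.
  by apply: (gen_cong_trans (sig s)); rewrite E; exact: gen_cong_sym (sig t).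
elim=> {s t}.
- move=> e f [pe pf]; exists (e * f); first exact: projM.
  by rewrite mulgA (projI pe) (projC pe pf) mulgA (projI pf).
- by move=> s; exists 1 => //; exact: proj1.
- by move=> s t _ [e pe E]; exists e.
- move=> s t u _ [e pe E] _ [f pf F]; exists (e * f); first exact: projM.
  by rewrite mulgA E -mulgA (projC pe pf) mulgA F -mulgA.
- move=> s s' t t' _ [e pe E] _ [f pf F].
  have key a : a * (bstar (e * a) * f) = e * a * f.
    by rewrite mulgA -bstar_mul (projK pe).
  have fE a : bstar (e * a) * f = bstar (e * (a * f)).
    by rewrite -{1}(projK pf) -bstarM (projK pf) mulgA.
  exists (bstar (e * t) * f); first by apply: projM => //; exact: proj_star.
  have K : bstar (e * t) * f = bstar (e * t') * f by rewrite !fE F.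
  rewrite -[LHS]mulgA key K -[RHS]mulgA key !mulgA E.
  by rewrite -[LHS]mulgA F mulgA.
- move=> s t _ _; exists (bstar s * bstar t).
    by apply: projM; exact: proj_star.
  by rewrite mulgA (projI (proj_star s)) (bstarC s t) mulgA (projI (proj_star t)).
- move=> s t _ _; exists (bplus s * bplus t).
    by apply: projM; exact: proj_plus.
  by rewrite mulgA (projI (proj_plus s)) (bplusC s t) mulgA (projI (proj_plus t)).
Qed.

Lemma bmaxP (FS : F_birestriction S) s : sigma_max s (bmax s).
Proof. exact: xgetPex (FS s). Qed.

Lemma sigma_max_unique s m m' : sigma_max s m -> sigma_max s m' -> m = m'.
Proof. by move=> [sm lem] [sm' lem']; apply: natle_anti; [exact: lem'|exact: lem]. Qed.

Lemma bmaxE s m : sigma_max s m -> bmax s = m.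
Proof.
move=> sm; apply: (sigma_max_unique (s := s)) => //.
by apply: (xgetPex s (P := [set m | sigma_max s m]%classic)); exists m.
Qed.

Lemma natle_bmax (FS : F_birestriction S) s t :
  sigma s t -> t = bmax s * bstar t.
Proof. by move=> st; apply/natle_star; exact: (bmaxP FS s).2. Qed.

End BirestrictionTheory.

(* A birestriction monoid up to an equivalence relation, to be quotiented *)
Record setoid_birestriction := SetoidBirestriction {
  sb_sort : choiceType;
  sb_eq : sb_sort -> sb_sort -> Prop;
  sb_mul : sb_sort -> sb_sort -> sb_sort;
  sb_star : sb_sort -> sb_sort;
  sb_plus : sb_sort -> sb_sort;
  sb_one : sb_sort;
  sb_refl : forall x, sb_eq x x;
  sb_sym : forall x y, sb_eq x y -> sb_eq y x;
  sb_trans : forall x y z, sb_eq x y -> sb_eq y z -> sb_eq x z;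
  sb_congM : forall x x' y y',
    sb_eq x x' -> sb_eq y y' -> sb_eq (sb_mul x y) (sb_mul x' y');
  sb_cong_star : forall x y, sb_eq x y -> sb_eq (sb_star x) (sb_star y);
  sb_cong_plus : forall x y, sb_eq x y -> sb_eq (sb_plus x) (sb_plus y);
  sb_A : forall x y z,
    sb_eq (sb_mul x (sb_mul y z)) (sb_mul (sb_mul x y) z);
  sb_1l : forall x, sb_eq (sb_mul sb_one x) x;
  sb_1r : forall x, sb_eq (sb_mul x sb_one) x;
  sb_mul_star : forall x, sb_eq (sb_mul x (sb_star x)) x;
  sb_starC : forall x y, sb_eq (sb_mul (sb_star x) (sb_star y))
                               (sb_mul (sb_star y) (sb_star x));
  sb_starM : forall x y, sb_eq (sb_star (sb_mul x (sb_star y)))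
                               (sb_mul (sb_star x) (sb_star y));
  sb_star_mul : forall x y, sb_eq (sb_mul (sb_star x) y)
                                  (sb_mul y (sb_star (sb_mul x y)));
  sb_plus_mul : forall x, sb_eq (sb_mul (sb_plus x) x) x;
  sb_plusC : forall x y, sb_eq (sb_mul (sb_plus x) (sb_plus y))
                               (sb_mul (sb_plus y) (sb_plus x));
  sb_plusM : forall x y, sb_eq (sb_plus (sb_mul (sb_plus x) y))
                               (sb_mul (sb_plus x) (sb_plus y));
  sb_mul_plus : forall x y, sb_eq (sb_mul x (sb_plus y))
                                  (sb_mul (sb_plus (sb_mul x y)) x);
  sb_plusK : forall x, sb_eq (sb_star (sb_plus x)) (sb_plus x);
  sb_starK : forall x, sb_eq (sb_plus (sb_star x)) (sb_star x)
}.

Section SetoidQuotient.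
Variable P : setoid_birestriction.

Definition sb_rel : rel (sb_sort P) := fun x y => `[< sb_eq x y >].

Fact sb_rel_equiv : equiv_class_of sb_rel.
Proof.
split=> [x|x y|y x z]; first by apply/asboolP; exact: sb_refl.
  by apply/asboolP/asboolP; exact: sb_sym.
by move=> /asboolP xy /asboolP yz; apply/asboolP; exact: sb_trans xy yz.
Qed.

Canonical sb_equiv := EquivRelPack sb_rel_equiv.

Definition sb_quot : Type := {eq_quot sb_equiv}.
HB.instance Definition _ := Choice.on sb_quot.
HB.instance Definition _ := Quotient.on sb_quot.

Definition sb_pi (x : sb_sort P) : sb_quot := \pi_sb_quot x.

Lemma sb_piP x y : sb_pi x = sb_pi y <-> sb_eq x y.
Proof.
split=> [/eqmodP/asboolP //|xy].
by apply/eqmodP/asboolP.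
Qed.

Lemma sb_reprK x : sb_eq (repr (sb_pi x)) x.
Proof. by apply/sb_piP; rewrite /sb_pi reprK. Qed.

Lemma sb_quotW (Q : sb_quot -> Prop) : (forall x, Q (sb_pi x)) -> forall q, Q q.
Proof. by move=> Qp q; rewrite -[q]reprK; exact: Qp. Qed.

Definition q_mul (x y : sb_quot) : sb_quot := sb_pi (sb_mul (repr x) (repr y)).
Definition q_one : sb_quot := sb_pi (sb_one P).
Definition q_star (x : sb_quot) : sb_quot := sb_pi (sb_star (repr x)).
Definition q_plus (x : sb_quot) : sb_quot := sb_pi (sb_plus (repr x)).

Fact q_mulE x y : q_mul (sb_pi x) (sb_pi y) = sb_pi (sb_mul x y).
Proof. by apply/sb_piP/sb_congM; exact: sb_reprK. Qed.
Fact q_starE x : q_star (sb_pi x) = sb_pi (sb_star x).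
Proof. by apply/sb_piP/sb_cong_star; exact: sb_reprK. Qed.
Fact q_plusE x : q_plus (sb_pi x) = sb_pi (sb_plus x).
Proof. by apply/sb_piP/sb_cong_plus; exact: sb_reprK. Qed.
Let qE := (q_mulE, q_starE, q_plusE).

Fact q_mulA : associative q_mul.
Proof. by do 3!elim/sb_quotW=> ?; rewrite !qE; apply/sb_piP/sb_A. Qed.
Fact q_1mul : left_id q_one q_mul.
Proof. by elim/sb_quotW=> ?; rewrite !qE; apply/sb_piP/sb_1l. Qed.
Fact q_mul1 : right_id q_one q_mul.
Proof. by elim/sb_quotW=> ?; rewrite !qE; apply/sb_piP/sb_1r. Qed.

HB.instance Definition _ := isMonoid.Build sb_quot q_mulA q_1mul q_mul1.

Fact q_mul_star (x : sb_quot) : x * q_star x = x.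
Proof. by elim/sb_quotW: x => ?; rewrite /mul/= !qE; apply/sb_piP/sb_mul_star. Qed.
Fact q_starC (x y : sb_quot) : q_star x * q_star y = q_star y * q_star x.
Proof.
by elim/sb_quotW: x y => ?; elim/sb_quotW=> ?; rewrite /mul/= !qE; apply/sb_piP/sb_starC.
Qed.
Fact q_starM (x y : sb_quot) : q_star (x * q_star y) = q_star x * q_star y.
Proof.
by elim/sb_quotW: x y => ?; elim/sb_quotW=> ?; rewrite /mul/= !qE; apply/sb_piP/sb_starM.
Qed.
Fact q_star_mul (x y : sb_quot) : q_star x * y = y * q_star (x * y).
Proof.
by elim/sb_quotW: x y => ?; elim/sb_quotW=> ?; rewrite /mul/= !qE; apply/sb_piP/sb_star_mul.
Qed.
Fact q_plus_mul (x : sb_quot) : q_plus x * x = x.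
Proof. by elim/sb_quotW: x => ?; rewrite /mul/= !qE; apply/sb_piP/sb_plus_mul. Qed.
Fact q_plusC (x y : sb_quot) : q_plus x * q_plus y = q_plus y * q_plus x.
Proof.
by elim/sb_quotW: x y => ?; elim/sb_quotW=> ?; rewrite /mul/= !qE; apply/sb_piP/sb_plusC.
Qed.
Fact q_plusM (x y : sb_quot) : q_plus (q_plus x * y) = q_plus x * q_plus y.
Proof.
by elim/sb_quotW: x y => ?; elim/sb_quotW=> ?; rewrite /mul/= !qE; apply/sb_piP/sb_plusM.
Qed.
Fact q_mul_plus (x y : sb_quot) : x * q_plus y = q_plus (x * y) * x.
Proof.
by elim/sb_quotW: x y => ?; elim/sb_quotW=> ?; rewrite /mul/= !qE; apply/sb_piP/sb_mul_plus.
Qed.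
Fact q_plusK (x : sb_quot) : q_star (q_plus x) = q_plus x.
Proof. by elim/sb_quotW: x => ?; rewrite !qE; apply/sb_piP/sb_plusK. Qed.
Fact q_starK (x : sb_quot) : q_plus (q_star x) = q_star x.
Proof. by elim/sb_quotW: x => ?; rewrite !qE; apply/sb_piP/sb_starK. Qed.

HB.instance Definition _ := Monoid_isBirestriction.Build sb_quot
  q_mul_star q_starC q_starM q_star_mul q_plus_mul q_plusC q_plusM q_mul_plus
  q_plusK q_starK.

Lemma sb_piM x y : sb_pi (sb_mul x y) = sb_pi x * sb_pi y.
Proof. by rewrite -q_mulE. Qed.
Lemma sb_pi_star x : sb_pi (sb_star x) = bstar (sb_pi x).
Proof. by rewrite -q_starE. Qed.
Lemma sb_pi_plus x : sb_pi (sb_plus x) = bplus (sb_pi x).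
Proof. by rewrite -q_plusE. Qed.
Lemma sb_pi1 : sb_pi (sb_one P) = 1.
Proof. by []. Qed.

End SetoidQuotient.

(* The quotient of S by the congruence generated by R *)
Section CongruenceQuotient.
Variables (S : birestrictionType) (R : S -> S -> Prop).

Definition cong_setoid : setoid_birestriction.
Proof.
refine (@SetoidBirestriction S (gen_cong R) *%g (@bstar S) (@bplus S) 1
  (@gen_cong_refl S R) (@gen_cong_sym S R) (@gen_cong_trans S R)
  (@gen_cong_mul S R) (@gen_cong_star S R) (@gen_cong_plus S R)
  _ _ _ _ _ _ _ _ _ _ _ _ _).
- by move=> x y z; rewrite mulgA; exact: gen_cong_refl.
- by move=> x; rewrite mul1g; exact: gen_cong_refl.
- by move=> x; rewrite mulg1; exact: gen_cong_refl.
- by move=> x; rewrite mul_bstar; exact: gen_cong_refl.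
- by move=> x y; rewrite bstarC; exact: gen_cong_refl.
- by move=> x y; rewrite bstarM; exact: gen_cong_refl.
- by move=> x y; rewrite bstar_mul; exact: gen_cong_refl.
- by move=> x; rewrite bplus_mul; exact: gen_cong_refl.
- by move=> x y; rewrite bplusC; exact: gen_cong_refl.
- by move=> x y; rewrite bplusM; exact: gen_cong_refl.
- by move=> x y; rewrite mul_bplus; exact: gen_cong_refl.
- by move=> x; rewrite bplusK; exact: gen_cong_refl.
- by move=> x; rewrite bstarK; exact: gen_cong_refl.
Defined.

Definition cong_quot : birestrictionType := sb_quot cong_setoid.
Definition cong_class (s : S) : cong_quot := @sb_pi cong_setoid s.

Lemma cong_classP s t : cong_class s = cong_class t <-> gen_cong R s t.
Proof. exact: (@sb_piP cong_setoid). Qed.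

Lemma cong_class_morphism : birestriction_morphism cong_class.
Proof.
split; [exact: (@sb_piM cong_setoid)|exact: (@sb_pi_star cong_setoid)|..].
  exact: (@sb_pi_plus cong_setoid).
exact: (@sb_pi1 cong_setoid).
Qed.

Lemma cong_quotW (Q : cong_quot -> Prop) :
  (forall s, Q (cong_class s)) -> forall q, Q q.
Proof. exact: (@sb_quotW cong_setoid). Qed.

End CongruenceQuotient.

(* Terms of type (2,1,1,0) *)
Inductive bterm (Y : Type) : Type :=
  | BVar of Y
  | BMul of bterm Y & bterm Y
  | BStar of bterm Y
  | BPlus of bterm Y
  | BOne.
Arguments BOne {Y}.

HB.instance Definition _ (Y : Type) := gen_eqMixin (bterm Y).
HB.instance Definition _ (Y : Type) := gen_choiceMixin (bterm Y).

Fixpoint beval (Y : Type) (M : birestrictionType) (f : Y -> M) (t : bterm Y) : M :=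
  match t with
  | BVar y => f y
  | BMul s t => beval f s * beval f t
  | BStar s => bstar (beval f s)
  | BPlus s => bplus (beval f s)
  | BOne => 1
  end.

(* The free birestriction monoid on Y: terms modulo the identities that hold
   in all birestriction monoids. *)
Section FreeBirestriction.
Variable Y : Type.

Definition bidentity (s t : bterm Y) : Prop :=
  forall (M : birestrictionType) (f : Y -> M), beval f s = beval f t.

Definition bterm_setoid : setoid_birestriction.
Proof.
refine (@SetoidBirestriction (bterm Y) bidentity
  (@BMul Y) (@BStar Y) (@BPlus Y) BOne _ _ _ _ _ _ _ _ _ _ _ _ _ _ _ _ _ _ _);
  rewrite /bidentity //=.
- by move=> x y z xy yz M f; rewrite xy yz.
- by move=> x x' y y' xx' yy' M f; rewrite xx' yy'.
- by move=> x y xy M f; rewrite xy.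
- by move=> x y xy M f; rewrite xy.
- by move=> *; rewrite mulgA.
- by move=> *; rewrite mul1g.
- by move=> *; rewrite mulg1.
- by move=> *; rewrite mul_bstar.
- by move=> *; rewrite bstarC.
- by move=> *; rewrite bstarM.
- by move=> *; rewrite bstar_mul.
- by move=> *; rewrite bplus_mul.
- by move=> *; rewrite bplusC.
- by move=> *; rewrite bplusM.
- by move=> *; rewrite mul_bplus.
- by move=> *; rewrite bplusK.
- by move=> *; rewrite bstarK.
Defined.

Definition FBR : birestrictionType := sb_quot bterm_setoid.
Definition fbr_gen (y : Y) : FBR := @sb_pi bterm_setoid (BVar y).

Lemma FBR_free (M : birestrictionType) (f : Y -> M) :
  exists! phi : FBR -> M,
    birestriction_morphism phi /\ (forall y, phi (fbr_gen y) = f y).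
Proof.
pose phi (q : FBR) : M := beval f (repr q).
have phiE t : phi (@sb_pi bterm_setoid t) = beval f t.
  exact: (@sb_reprK bterm_setoid t).
exists phi; split.
  split=> [|y]; last by rewrite phiE.
  split=> [x y|x|x|].
  - elim/(@sb_quotW bterm_setoid): x => x; elim/(@sb_quotW bterm_setoid): y => y.
    by rewrite -sb_piM !phiE.
  - by elim/(@sb_quotW bterm_setoid): x => x; rewrite -sb_pi_star !phiE.
  - by elim/(@sb_quotW bterm_setoid): x => x; rewrite -sb_pi_plus !phiE.
  - by rewrite -(sb_pi1 bterm_setoid) phiE.
move=> psi [[psiM psiS psiP psi1] psig]; apply/funext.
elim/(@sb_quotW bterm_setoid)=> t; rewrite phiE.
elim: t => [y|s IHs t IHt|s IHs|s IHs|] /=.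
- by rewrite psig.
- by rewrite (@sb_piM bterm_setoid) psiM IHs IHt.
- by rewrite (@sb_pi_star bterm_setoid) psiS IHs.
- by rewrite (@sb_pi_plus bterm_setoid) psiP IHs.
- by rewrite (@sb_pi1 bterm_setoid) psi1.
Qed.

End FreeBirestriction.

Definition BRestr (Y : Type) (R : FBR Y -> FBR Y -> Prop) : birestrictionType :=
  cong_quot R.
Definition brestr_gen (Y : Type) (R : FBR Y -> FBR Y -> Prop) (y : Y) : BRestr R :=
  cong_class R (fbr_gen y).

(* Terms of type (2,1,1,1,0) *)
Inductive fterm (X : Type) : Type :=
  | FVar of X
  | FMul of fterm X & fterm X
  | FStar of fterm X
  | FPlus of fterm X
  | FMax of fterm X
  | FOne.
Arguments FOne {X}.

HB.instance Definition _ (X : Type) := gen_eqMixin (fterm X).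
HB.instance Definition _ (X : Type) := gen_choiceMixin (fterm X).

Fixpoint feval (X : Type) (M : birestrictionType) (f : X -> M) (t : fterm X) : M :=
  match t with
  | FVar x => f x
  | FMul s t => feval f s * feval f t
  | FStar s => bstar (feval f s)
  | FPlus s => bplus (feval f s)
  | FMax s => bmax (feval f s)
  | FOne => 1
  end.

(* The free F-birestriction monoid on X: terms modulo the identities that hold
   in all F-birestriction monoids. *)
Section FreeFBirestriction.
Variable X : Type.

Definition fidentity (s t : fterm X) : Prop :=
  forall M : birestrictionType, F_birestriction M ->
  forall f : X -> M, feval f s = feval f t.

Definition fterm_setoid : setoid_birestriction.
Proof.
refine (@SetoidBirestriction (fterm X) fidentity
  (@FMul X) (@FStar X) (@FPlus X) FOne _ _ _ _ _ _ _ _ _ _ _ _ _ _ _ _ _ _ _);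
  rewrite /fidentity //=.
- by move=> x y xy M FM f; rewrite xy.
- by move=> x y z xy yz M FM f; rewrite xy // yz.
- by move=> x x' y y' xx' yy' M FM f; rewrite xx' // yy'.
- by move=> x y xy M FM f; rewrite xy.
- by move=> x y xy M FM f; rewrite xy.
- by move=> *; rewrite mulgA.
- by move=> *; rewrite mul1g.
- by move=> *; rewrite mulg1.
- by move=> *; rewrite mul_bstar.
- by move=> *; rewrite bstarC.
- by move=> *; rewrite bstarM.
- by move=> *; rewrite bstar_mul.
- by move=> *; rewrite bplus_mul.
- by move=> *; rewrite bplusC.
- by move=> *; rewrite bplusM.
- by move=> *; rewrite mul_bplus.
- by move=> *; rewrite bplusK.
- by move=> *; rewrite bstarK.
Defined.

Definition FFBR : birestrictionType := sb_quot fterm_setoid.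
Definition ffbr_gen (x : X) : FFBR := @sb_pi fterm_setoid (FVar x).

Let pi (t : fterm X) : FFBR := @sb_pi fterm_setoid t.

Lemma FFBR_sigma_max (s : fterm X) : sigma_max (pi s) (pi (FMax s)).
Proof.
split=> [|t].
  apply/sigmaP; exists (bstar (pi s)); first exact: proj_star.
  rewrite mul_bstar -(@sb_pi_star fterm_setoid) -(@sb_piM fterm_setoid).
  by apply/sb_piP => M FM f /=; apply: natle_bmax => //; exact: gen_cong_refl.
elim/(@sb_quotW fterm_setoid): t => t /sigmaP[e /projK].
elim/(@sb_quotW fterm_setoid): e => e.
rewrite -(@sb_pi_star fterm_setoid) -!(@sb_piM fterm_setoid).
move=> /sb_piP pe /sb_piP E.
apply/natle_star; rewrite -(@sb_pi_star fterm_setoid) -(@sb_piM fterm_setoid).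
apply/sb_piP => M FM f /=; apply: natle_bmax => //.
apply/sigmaP; exists (feval f e); last exact: E M FM f.
by exists (feval f e); exact/esym/(pe M FM f).
Qed.

Lemma FFBR_F_birestriction : F_birestriction FFBR.
Proof.
elim/(@sb_quotW fterm_setoid)=> s; exists (pi (FMax s)); exact: FFBR_sigma_max.
Qed.

Lemma FFBR_free (M : birestrictionType) (FM : F_birestriction M) (f : X -> M) :
  exists! phi : FFBR -> M,
    F_birestriction_morphism phi /\ (forall x, phi (ffbr_gen x) = f x).
Proof.
pose phi (q : FFBR) : M := feval f (repr q).
have phiE t : phi (pi t) = feval f t by exact: (@sb_reprK fterm_setoid t M FM f).
exists phi; split.
  split=> [|y]; last by rewrite phiE.
  split=> [|x]; last first.
    elim/(@sb_quotW fterm_setoid): x => x.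
    by rewrite (bmaxE (FFBR_sigma_max x)) !phiE.
  split=> [x y|x|x|].
  - elim/(@sb_quotW fterm_setoid): x => x; elim/(@sb_quotW fterm_setoid): y => y.
    by rewrite -sb_piM !phiE.
  - by elim/(@sb_quotW fterm_setoid): x => x; rewrite -sb_pi_star !phiE.
  - by elim/(@sb_quotW fterm_setoid): x => x; rewrite -sb_pi_plus !phiE.
  - by rewrite -(sb_pi1 fterm_setoid) phiE.
move=> psi [[[psiM psiS psiP psi1] psiF] psig]; apply/funext.
elim/(@sb_quotW fterm_setoid)=> t; rewrite phiE.
elim: t => [y|s IHs t IHt|s IHs|s IHs|s IHs|] /=.
- by rewrite psig.
- by rewrite (@sb_piM fterm_setoid) psiM IHs IHt.
- by rewrite (@sb_pi_star fterm_setoid) psiS IHs.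
- by rewrite (@sb_pi_plus fterm_setoid) psiP IHs.
- by rewrite -[sb_pi _]/(pi (FMax s)) -(bmaxE (FFBR_sigma_max s)) psiF IHs.
- by rewrite (@sb_pi1 fterm_setoid) psi1.
Qed.

End FreeFBirestriction.

(* The free semigroup X^+ *)
Definition fsemigroup (X : Type) : Type := {w : seq X | ~~ nilp w}.

Definition fsg_letter (X : Type) (x : X) : fsemigroup X :=
  exist _ [:: x] isT.

Fact fsg_mul_subproof (X : Type) (u v : fsemigroup X) :
  ~~ nilp (sval u ++ sval v).
Proof. by case: u => -[]. Qed.

Definition fsg_mul (X : Type) (u v : fsemigroup X) : fsemigroup X :=
  exist _ (sval u ++ sval v) (fsg_mul_subproof u v).

Definition fsg_eval (X : Type) (M : monoidType) (f : X -> M)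
    (u : fsemigroup X) : M := \prod_(x <- sval u) f x.

(* In X + X^+, inl x is the generator x and inr u is the generator u-bar. Each
   relation a >= b is imposed as b = a b^*. *)
Inductive calF_rel (X : Type) :
    FBR (X + fsemigroup X) -> FBR (X + fsemigroup X) -> Prop :=
  | calF_rel_letter (x : X) :
      let a := fbr_gen (inr (fsg_letter x)) in
      let b := fbr_gen (inl x) in
      calF_rel b (a * bstar b)
  | calF_rel_mul (u v : fsemigroup X) :
      let a := fbr_gen (inr (fsg_mul u v)) in
      let b := fbr_gen (inr u) * fbr_gen (inr v) in
      calF_rel b (a * bstar b).

Definition calF (X : Type) : birestrictionType := BRestr (@calF_rel X).

Definition calF_gen (X : Type) (y : X + fsemigroup X) : calF X :=
  brestr_gen (@calF_rel X) y.

Definition ffbr_assign (X : Type) (y : X + fsemigroup X) : FFBR X :=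
  match y with
  | inl x => ffbr_gen x
  | inr u => bmax (fsg_eval (@ffbr_gen X) u)
  end.

(* Main.v *)
(* Sending x to [:: x], u-bar to u and every projection to the empty word
   identifies calF / sigma with the free monoid X^*.  By induction on terms,
   every element of calF lies below the bar of its word, where the bar of the
   empty word is 1.  Hence calF is an F-birestriction monoid with
   s^m = bar (word s).  The canonical maps between FFBR X and calF X given by
   the two universal properties are then mutually inverse; the point is that
   the map out of calF preserves ^m, the case of the empty word being 1^m = 1. *)
Require Import Defs.
From HB Require Import structures.
From mathcomp Require Import all_boot monoid generic_quotient.
From mathcomp Require Import boolp classical_sets.

Set Implicit Arguments.
Unset Strict Implicit.
Unset Printing Implicit Defensive.

Local Open Scope group_scope.

(** * Natural order and class maxima under multiplication *)

Section NaturalOrder.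
Variable S : birestrictionType.
Implicit Types s t u e : S.

Lemma natle_mul_proj t e : projection e -> natle (t * e) t.
Proof.
move=> pe; exists (bplus (t * e)); first exact: proj_plus.
by rewrite -mul_bplus -{2}(projK pe) bstarK projK.
Qed.

Lemma natle_refl s : natle s s.
Proof. by exists 1; [exact: proj1|rewrite mul1g]. Qed.

Lemma natle_trans s t u : natle s t -> natle t u -> natle s u.
Proof.
move=> [e pe ->] [f pf ->]; exists (e * f); first exact: projM.
by rewrite mulgA.
Qed.

(** [bstar_mul] carries the inner projection to the right end, which leaves [t * t'] times a
    projection. *)
Lemma natleM s s' t t' : natle s t -> natle s' t' -> natle (s * s') (t * t').
Proof.
move=> /natle_star -> /natle_star ->.
rewrite mulgA -(mulgA t) bstar_mul mulgA -mulgA.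
by apply: natle_mul_proj; apply: projM; exact: proj_star.
Qed.

Lemma natle1 e : projection e -> natle e 1.
Proof. by move=> pe; exists e; rewrite ?mulg1. Qed.

Lemma natle1_eq t : natle 1 t -> t = 1.
Proof. by move=> /natle_star; rewrite (projK (proj1 S)) mulg1. Qed.

Lemma natle_sigma s t : natle s t -> sigma s t.
Proof.
move=> /natle_star st; apply/sigmaP; exists (bstar s); first exact: proj_star.
by rewrite mul_bstar.
Qed.

Lemma bmax_sigma s t : F_birestriction S -> sigma s t -> bmax s = bmax t.
Proof.
move=> FS st; apply: bmaxE; have [tm le_m] := bmaxP FS t.
split; first exact: gen_cong_trans st tm.
by move=> r sr; apply: le_m; apply: gen_cong_trans sr; exact: gen_cong_sym.
Qed.

(** The maximum of the class of 1 lies above 1, and only 1 does. *)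
Lemma bmax1 : F_birestriction S -> bmax 1 = 1 :> S.
Proof. by move=> FS; apply/natle1_eq/(bmaxP FS 1).2; exact: gen_cong_refl. Qed.

(** Since [sigma] is a congruence, the left side lies in the class of [s * t]. This supplies the
    product relations between bars in [FFBR X]. *)
Lemma natle_bmaxM s t : F_birestriction S -> natle (bmax s * bmax t) (bmax (s * t)).
Proof.
move=> FS; apply: (bmaxP FS (s * t)).2.
by apply: gen_cong_mul; [exact: (bmaxP FS s).1|exact: (bmaxP FS t).1].
Qed.

End NaturalOrder.

(** * Behaviour under morphisms *)

Section Morphisms.
Variables (S T : birestrictionType) (f : S -> T).
Hypothesis f_mor : birestriction_morphism f.

Lemma sigma_morphism s t : sigma s t -> sigma (f s) (f t).
Proof.
have [fM fS _ _] := f_mor.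
move=> /sigmaP[_ [e ->] E]; apply/sigmaP; exists (f (bstar e)).
  by exists (f e); rewrite fS.
by rewrite -!fM E.
Qed.

Lemma fsg_eval_morphism (X : Type) (g : X -> S) u :
  f (fsg_eval g u) = fsg_eval (f \o g) u.
Proof.
have [fM _ _ f1] := f_mor.
by rewrite /fsg_eval; elim: (sval u) => [|x w IH]; rewrite ?big_nil ?big_cons ?fM ?IH.
Qed.

Lemma comp_birestriction_morphism (R : birestrictionType) (g : R -> S) :
  birestriction_morphism g -> birestriction_morphism (f \o g).
Proof.
move: f_mor => [fM fS fP f1] [gM gS gP g1].
by split=> * /=; rewrite ?gM ?gS ?gP ?g1.
Qed.

End Morphisms.

(** * Presentations: induction on generators and the universal property *)

Section Presentation.
Variables (Y : Type) (R : FBR Y -> FBR Y -> Prop).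

Lemma BRestr_ind (Q : BRestr R -> Prop) :
  (forall y, Q (brestr_gen R y)) -> (forall s t, Q s -> Q t -> Q (s * t)) ->
  (forall s, Q s -> Q (bstar s)) -> (forall s, Q s -> Q (bplus s)) -> Q 1 ->
  forall s, Q s.
Proof.
have [cM cS cP c1] := cong_class_morphism R.
move=> Qgen Qmul Qstar Qplus Q1; elim/cong_quotW.
elim/(@sb_quotW (bterm_setoid Y)); elim=> [y|s IHs t IHt|s IHs|s IHs|].
- exact: Qgen.
- by rewrite (@sb_piM (bterm_setoid Y)) cM; exact: Qmul.
- by rewrite (@sb_pi_star (bterm_setoid Y)) cS; exact: Qstar.
- by rewrite (@sb_pi_plus (bterm_setoid Y)) cP; exact: Qplus.
- by rewrite (@sb_pi1 (bterm_setoid Y)) c1.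
Qed.

(** The kernel of a morphism is a congruence, so it contains the one generated by [Q]. *)
Lemma gen_cong_morphism (S M : birestrictionType) (Q : S -> S -> Prop)
    (phi : S -> M) : birestriction_morphism phi ->
  (forall s t, Q s t -> phi s = phi t) ->
  forall s t, gen_cong Q s t -> phi s = phi t.
Proof.
move=> [phiM phiS phiP phi1] phiQ s t; elim=> {s t} //.
- by move=> s t u _ -> _ ->.
- by move=> s s' t t' _ E _ E'; rewrite !phiM E E'.
- by move=> s t _ E; rewrite !phiS E.
- by move=> s t _ E; rewrite !phiP E.
Qed.

(** The extension of [f] supplied by [FBR_free] has no name, so the hypothesis ranges over every
    extension. *)
Lemma BRestr_lift (M : birestrictionType) (f : Y -> M) :
  (forall phi : FBR Y -> M, birestriction_morphism phi ->
     (forall y, phi (fbr_gen y) = f y) -> forall s t, R s t -> phi s = phi t) ->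
  exists2 phi : BRestr R -> M,
    birestriction_morphism phi & forall y, phi (brestr_gen R y) = f y.
Proof.
move=> fR; have [phi0 [[phi0_mor phi0g] _]] := FBR_free f.
have phi0R := gen_cong_morphism phi0_mor (fR _ phi0_mor phi0g).
have [cM cS cP c1] := cong_class_morphism R.
have [fM fS fP f1] := phi0_mor.
(* [phi0R] makes the choice of representative harmless. *)
pose phi (q : BRestr R) : M := phi0 (repr q).
have phiE s : phi (cong_class R s) = phi0 s.
  by apply: phi0R; exact: (@sb_reprK (cong_setoid R)).
exists phi => [|y]; last by rewrite phiE.
split=> [x y|x|x|].
- by elim/cong_quotW: x => x; elim/cong_quotW: y => y; rewrite -cM !phiE.
- by elim/cong_quotW: x => x; rewrite -cS !phiE.
- by elim/cong_quotW: x => x; rewrite -cP !phiE.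
- by rewrite -c1 phiE.
Qed.

End Presentation.

(* The free monoid X^*, with trivial unary operations. *)
Definition words (X : Type) : Type := seq X.

Section Words.
Variable X : Type.

HB.instance Definition _ := gen_eqMixin (words X).
HB.instance Definition _ := gen_choiceMixin (words X).
HB.instance Definition _ :=
  isMonoid.Build (words X) (@catA X) (@cat0s X) (@cats0 X).

(** Serves as both unary operations: 1 becomes the only projection, so the order and [sigma]
    collapse to equality. *)
Let triv (w : words X) : words X := 1.

Fact words_mul_triv (x : words X) : x * triv x = x.
Proof. exact: mulg1. Qed.
Fact words_triv_mul (x : words X) : triv x * x = x.
Proof. exact: mul1g. Qed.
Fact words_trivC (x y : words X) : triv x * triv y = triv y * triv x.
Proof. by []. Qed.
Fact words_trivM (x y : words X) : triv (x * y) = triv x * triv y.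
Proof. by rewrite /triv mulg1. Qed.
Fact words_triv_commute (x y : words X) : triv x * y = y * triv (x * y).
Proof. by rewrite /triv mul1g mulg1. Qed.
Fact words_commute_triv (x y : words X) : x * triv y = triv (x * y) * x.
Proof. by rewrite /triv mul1g mulg1. Qed.
Fact words_trivK (x : words X) : triv (triv x) = triv x.
Proof. by []. Qed.

HB.instance Definition _ := Monoid_isBirestriction.Build (words X)
  words_mul_triv words_trivC (fun x y => words_trivM x (triv y)) words_triv_commute
  words_triv_mul words_trivC (fun x y => words_trivM (triv x) y) words_commute_triv
  words_trivK words_trivK.

Lemma words_sigma (v w : words X) : sigma v w -> v = w.
Proof. by move=> /sigmaP[_ [e ->]]; rewrite -[bstar e]/1 !mulg1. Qed.

Lemma fsg_eval_letters (u : fsemigroup X) :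
  fsg_eval (fun x => [:: x] : words X) u = sval u.
Proof.
rewrite /fsg_eval; elim: (sval u) => [|x w IH]; first by rewrite big_nil.
by rewrite big_cons IH.
Qed.

End Words.

(** * Words and maxima in [calF X], and its comparison with [FFBR X] *)

Section CalF.
Variable X : Type.
Local Notation F := (calF X).

(** By [natle_star], the encoding [b = a * bstar b] of a relation says that [b] lies below [a]. *)
Lemma calF_lift (M : birestrictionType) (f : X + fsemigroup X -> M) :
  (forall x, natle (f (inl x)) (f (inr (fsg_letter x)))) ->
  (forall u v, natle (f (inr u) * f (inr v)) (f (inr (fsg_mul u v)))) ->
  exists2 phi : F -> M,
    birestriction_morphism phi & forall y, phi (calF_gen y) = f y.
Proof.
move=> fx fu; apply: BRestr_lift => phi [phiM phiS _ _] phig _ _ [x a b|u v a b]; rewrite {}/a {}/b.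
  by rewrite phiM phiS !phig; exact/natle_star.
by rewrite !(phiM, phiS, phig); exact/natle_star.
Qed.

Lemma calF_gen_letter x :
  natle (calF_gen (inl x)) (calF_gen (inr (fsg_letter x)) : F).
Proof.
have [cM cS _ _] := cong_class_morphism (@calF_rel X).
apply/natle_star; rewrite -cS -cM; apply/cong_classP/gen_cong_base.
exact: calF_rel_letter.
Qed.

Lemma calF_gen_mul u v :
  natle (calF_gen (inr u) * calF_gen (inr v)) (calF_gen (inr (fsg_mul u v)) : F).
Proof.
have [cM cS _ _] := cong_class_morphism (@calF_rel X).
apply/natle_star; rewrite -cM -cS -cM; apply/cong_classP/gen_cong_base.
exact: calF_rel_mul.
Qed.

Definition gen_word (y : X + fsemigroup X) : words X :=
  match y with inl x => [:: x] | inr u => sval u end.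

(** The two sides of each inequality spell the same word, so reflexivity suffices. *)
Lemma calF_word_exists : exists w : F -> words X,
  birestriction_morphism w /\ forall y, w (calF_gen y) = gen_word y.
Proof.
have [|u v|w w_mor wg] := @calF_lift (words X) gen_word; last by exists w.
  by move=> x; exact: natle_refl.
exact: natle_refl.
Qed.

Definition calF_word : F -> words X := sval (cid calF_word_exists).

Lemma calF_word_morphism : birestriction_morphism calF_word.
Proof. by rewrite /calF_word; case: cid => w []. Qed.

Lemma calF_word_gen y : calF_word (calF_gen y) = gen_word y.
Proof. by rewrite /calF_word; case: cid => w []. Qed.

Definition calF_bar (w : words X) : F :=
  match w with
  | [::] => 1
  | x :: w' => calF_gen (inr (exist _ (x :: w') isT))
  end.

(** The nonemptiness proof stored in [u] need not be literally [isT]; irrelevance of boolean proofs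
    identifies the two. *)
Lemma calF_bar_sval (u : fsemigroup X) : calF_bar (sval u) = calF_gen (inr u).
Proof. by case: u => -[|x w] //= p; rewrite (bool_irrelevance p isT). Qed.

Lemma calF_barM v w : natle (calF_bar v * calF_bar w) (calF_bar (v * w)).
Proof.
case: v w => [|x v] [|y w]; rewrite ?mul1g ?mulg1; try exact: natle_refl.
pose u1 : fsemigroup X := exist _ (x :: v) isT.
pose u2 : fsemigroup X := exist _ (y :: w) isT.
rewrite -[calF_bar (_ * _)]/(calF_bar (sval (fsg_mul u1 u2))) calF_bar_sval.
exact: (calF_gen_mul u1 u2).
Qed.

(** Products reduce to [calF_barM]. Projections have the empty word, whose bar 1 lies above all of
    them. *)
Lemma natle_calF_bar s : natle s (calF_bar (calF_word s)).
Proof.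
have [wM wS wP w1] := calF_word_morphism.
elim/BRestr_ind: s => [y|s t IHs IHt|s _|s _|].
- rewrite -/(calF_gen y) calF_word_gen; case: y => [x|u] /=.
    exact: calF_gen_letter.
  by rewrite calF_bar_sval; exact: natle_refl.
- by rewrite wM; apply: natle_trans (calF_barM _ _); exact: natleM.
- by rewrite wS; apply: natle1; exact: proj_star.
- by rewrite wP; apply: natle1; exact: proj_plus.
- by rewrite w1; exact: natle_refl.
Qed.

Lemma calF_word_sigma s t : sigma s t -> calF_word s = calF_word t.
Proof. by move=> st; apply/words_sigma/sigma_morphism => //; exact: calF_word_morphism. Qed.

(** Elements of one [sigma]-class have the same word, hence lie below the same bar. *)
Lemma calF_bar_max s : sigma_max s (calF_bar (calF_word s)).
Proof.
split=> [|t st]; first exact/natle_sigma/natle_calF_bar.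
by rewrite (calF_word_sigma st); exact: natle_calF_bar.
Qed.

Lemma calF_F_birestriction : F_birestriction F.
Proof. by move=> s; exists (calF_bar (calF_word s)); exact: calF_bar_max. Qed.

Lemma calF_bmax s : bmax s = calF_bar (calF_word s).
Proof. exact/bmaxE/calF_bar_max. Qed.

Lemma calF_word_eval u :
  calF_word (fsg_eval (fun x => calF_gen (inl x)) u) = sval u.
Proof.
rewrite (fsg_eval_morphism calF_word_morphism) -[RHS]fsg_eval_letters.
by apply: eq_bigr => x _; exact: calF_word_gen.
Qed.

Lemma calF_bmax_eval u :
  bmax (fsg_eval (fun x => calF_gen (inl x)) u) = calF_gen (inr u) :> F.
Proof. by rewrite calF_bmax calF_word_eval calF_bar_sval. Qed.

(** Freeness prescribes the values on letters; preservation of [bmax] then forces those on bars, by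
    [calF_bmax_eval]. *)
Lemma FFBR_to_calF : exists2 psi : FFBR X -> F,
  F_birestriction_morphism psi & forall y, psi (ffbr_assign y) = calF_gen y.
Proof.
have [psi [[psi_mor psig] _]] :=
  FFBR_free calF_F_birestriction (fun x => calF_gen (inl x)).
exists psi => // -[x|u] /=; first exact: psig.
rewrite psi_mor.2 (fsg_eval_morphism psi_mor.1) -calF_bmax_eval.
by congr bmax; apply: eq_bigr => x _; exact: psig.
Qed.

(** The defining relations become $x \le x^m$ and $u^m v^m \le (uv)^m$ in [FFBR X]. *)
Lemma calF_to_FFBR : exists2 theta : F -> FFBR X,
  F_birestriction_morphism theta & forall y, theta (calF_gen y) = ffbr_assign y.
Proof.
have FF := FFBR_F_birestriction (X := X).
have [x|u v|theta theta_mor thetag] := @calF_lift (FFBR X) (@ffbr_assign X).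
- rewrite /= /fsg_eval big_cons big_nil mulg1.
  exact/(bmaxP FF (ffbr_gen x)).2/gen_cong_refl.
- by rewrite /= [fsg_eval _ (fsg_mul _ _)]big_cat; exact: natle_bmaxM.
exists theta => //; split=> // s; have [_ _ _ theta1] := theta_mor.
(* Thus [theta s] may be replaced by the image of a bar, whose value is known. *)
have st : sigma s (calF_bar (calF_word s)).
  exact/natle_sigma/natle_calF_bar.
rewrite (bmax_sigma FF (sigma_morphism theta_mor st)) calF_bmax.
case: (calF_word s) => [|x w] /=; first by rewrite theta1 bmax1.
(* The image of a bar is already a maximum, and [bmax] is idempotent. *)
rewrite thetag /=.
exact/(bmax_sigma FF)/(bmaxP FF _).1.
Qed.

End CalF.

Theorem theorem7p8 (X : Type) (X_neq0 : inhabited X) :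
  [/\ exists phi : FFBR X -> calF X,
        [/\ bijective phi, birestriction_morphism phi
          & forall y : X + fsemigroup X, phi (ffbr_assign y) = calF_gen y],
      F_birestriction (calF X)
    & exists psi : FFBR X -> calF X,
        [/\ bijective psi, F_birestriction_morphism psi
          & forall x : X, psi (ffbr_gen x) = calF_gen (inl x)]].
Proof.
have [psi psi_mor psig] := FFBR_to_calF X.
have [theta theta_mor thetag] := calF_to_FFBR X.
have [psi_br psi_max] := psi_mor; have [theta_br theta_max] := theta_mor.
have psi_bij : bijective psi.
  exists theta => s.
    (* Both [id] and [theta \o psi] extend the generator map of [FFBR X], so uniqueness identifies
       them. *)
    have [chi [_ chi_unique]] :=
      FFBR_free (@FFBR_F_birestriction X) (@ffbr_gen X).
    have chi_id : chi = id by apply: chi_unique.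
    have chi_comp : chi = theta \o psi.
      apply: chi_unique; split=> [|x]; last by rewrite /= (psig (inl x)) thetag.
      split=> [|r]; first exact: comp_birestriction_morphism.
      by rewrite /= psi_max theta_max.
    by rewrite -[LHS]/((theta \o psi) s) -chi_comp chi_id.
  have [cM cS cP c1] := comp_birestriction_morphism psi_br theta_br.
  rewrite /= in cM cS cP c1.
  (* The other composite is a morphism fixing the generators of [calF X], hence is the identity. *)
  elim/BRestr_ind: s => [y|s t IHs IHt|s IHs|s IHs|].
  - by rewrite [theta _]thetag psig.
  - by rewrite cM IHs IHt.
  - by rewrite cS IHs.
  - by rewrite cP IHs.
  - exact: c1.
(* One map witnesses both isomorphisms. *)
split; [by exists psi|exact: calF_F_birestriction|exists psi; split=> // x].
exact: (psig (inl x)).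
Qed.
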